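(* Every $3$-edge-connected signed graph admits a circular $6$-flow, and every $4$-edge-connected signed graph admits a circular $4$-flow.
   Context: Graphs are finite, may have multiple edges but no loops; a signed graph $(G,\sigma)$ has $\sigma:E(G)\to\{+,-\}$ and is $k$-edge-connected if $G$ is. For an orientation $D$ and $f:E(G)\to\mathbb{R}$, $\partial_Df(v)$ is the sum of $f$ over out-arcs at $v$ minus the sum over in-arcs. A circular $r$-flow ($r\ge2$) is a pair $(D,f)$ with $D$ an orientation of $G$ and $f:E(G)\to(-r,r)$ such that $|f(e)|\in[1,r-1]$ for positive edges, $|f(e)|\in[0,\frac r2-1]\cup[\frac r2+1,r)$ for negative edges, and $\partial_Df(v)=0$ at every vertex. *)

(* Defs.v *)
From HB Require Import structures.
From mathcomp Require Import all_boot all_order all_algebra.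
From mathcomp Require Import reals.
Set Implicit Arguments.
Unset Strict Implicit.
Unset Printing Implicit Defensive.
Import Order.TTheory GRing.Theory Num.Theory.
Local Open Scope ring_scope.

(* Parallel edges are distinct elements of [edge] with the same [ends];
   [card_ends] forbids loops. *)
Record multigraph := Multigraph {
  vertex : finType;
  edge : finType;
  ends : edge -> {set vertex};
  card_ends : forall e, #|ends e| = 2%N }.

Record signed_graph := SignedGraph {
  underlying :> multigraph;
  positive : pred (edge underlying) (* the remaining edges are negative *) }.

Definition adj_avoiding (G : multigraph) (F : {set edge G}) : rel (vertex G) :=
  fun u v => [exists e, (e \notin F) && (ends e == [set u; v])].

Definition connected_avoiding (G : multigraph) (F : {set edge G}) : Prop :=
  (exists u : vertex G, True) /\
  forall u v : vertex G, connect (adj_avoiding F) u v.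

(* The one-vertex graph is k-edge-connected for every k. *)
Definition edge_connected (k : nat) (G : multigraph) : Prop :=
  forall F : {set edge G}, (#|F| < k)%N -> connected_avoiding F.

Record orientation (G : multigraph) := Orientation {
  tail : edge G -> vertex G;
  head : edge G -> vertex G;
  tail_headE : forall e, ends e = [set tail e; head e] }.

Definition boundary (R : realType) (G : multigraph) (D : orientation G)
    (f : edge G -> R) (v : vertex G) : R :=
  \sum_(e | tail D e == v) f e - \sum_(e | head D e == v) f e.

(* Meant for 2 <= r. *)
Definition circular_flow (R : realType) (r : R) (G : signed_graph)
    (D : orientation G) (f : edge G -> R) : Prop :=
  [/\ forall e, f e \in `]- r, r[,
      forall e, positive e -> `|f e| \in `[1, r - 1],
      forall e, ~~ positive e ->
        (`|f e| \in `[0, r / 2 - 1]) || (`|f e| \in `[r / 2 + 1, r[)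
    & forall v, boundary D f v = 0].

Definition admits_circular_flow (R : realType) (r : R) (G : signed_graph) : Prop :=
  exists (D : orientation G) (f : edge G -> R), circular_flow r D f.

(* Main.v *)
Require Import Defs.
From mathcomp Require Import all_boot all_order all_algebra.
From mathcomp Require Import reals zify ring.
Set Implicit Arguments.
Unset Strict Implicit.
Unset Printing Implicit Defensive.
Import Order.TTheory GRing.Theory Num.Theory.

(** Let k = 3 for the 6-flow and k = 2 for the 4-flow. It suffices to find a
    connected spanning set X of edges and an integer flow phi with no value
    divisible by k on X. Indeed a flow psi can be prescribed arbitrarily off X,
    so that phi + k psi avoids 0 modulo 2k on positive edges and k modulo 2k on
    negative ones, and a flow modulo 2k lifts to an integer flow with values in
    (-2k, 2k) by pushing excess along residual paths (Tutte).

    For k = 2, a 4-edge-connected graph has disjoint connected spanning sets X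
    and Y (Nash-Williams, Tutte); phi is a flow prescribed to be 1 off Y.

    For k = 3, the edge set is exhausted by a non-separating ear decomposition.
    Let U be the set of vertices reached so far and R the connected set of
    remaining edges. Choose T in R connected and maximal such that R \ T still
    contains an ear of U. By maximality, every edge of R \ T that meets T lies
    on all ears in R \ T, and 3-edge-connectivity then forces R \ T to be a
    chord of U, or a connected set S of vertices all met by T together with two
    edges from S to U. The chord, resp. the two edges, go into X; a suitable
    multiple of a circulation through them makes phi nonzero modulo 3 there. *)

(** * Connectivity by edge sets *)

Section Connectivity.
Variable G : multigraph.
Notation V := (vertex G).
Notation E := (edge G).
Implicit Types (F Q T U : {set E}) (S W : {set V}) (u v x y : V) (e f : E).

Definition adj F : rel V := fun u v => [exists e in F, ends e == [set u; v]].
Definition conn F : rel V := connect (adj F).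
Definition component F u : {set V} := [set v | conn F u v].
Definition cut S : {set E} :=
  [set e | (ends e :&: S != set0) && ~~ (ends e \subset S)].
Definition touched F : {set V} := \bigcup_(e in F) ends e.

Lemma adj_sym F : symmetric (adj F).
Proof. by move=> u v; apply: eq_existsb => e; rewrite setUC. Qed.

Lemma conn_sym F : symmetric (conn F).
Proof. exact/sym_connect_sym/adj_sym. Qed.

Lemma conn_refl F u : conn F u u.
Proof. exact: connect0. Qed.

Lemma conn_trans F v u w : conn F u v -> conn F v w -> conn F u w.
Proof. exact: connect_trans. Qed.

Lemma ends_eq e u v : u \in ends e -> v \in ends e -> u != v ->
  ends e = [set u; v].
Proof.
move=> ue ve uv; apply/eqP; rewrite eq_sym eqEcard subUset !sub1set ue ve /=.
by rewrite (card_ends e) cards2 uv.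
Qed.

Lemma endsP e : exists u v, u != v /\ ends e = [set u; v].
Proof.
by have /eqP/cards2P[u [v [uv ->]]] := card_ends e; exists u, v.
Qed.

Lemma ends_inhabited e : exists v, v \in ends e.
Proof. by apply/card_gt0P; rewrite card_ends. Qed.

Lemma conn_edge F e u v :
  e \in F -> u \in ends e -> v \in ends e -> conn F u v.
Proof.
move=> eF ue ve; case: (eqVneq u v) => [->|uv]; first exact: conn_refl.
by apply/connect1/exists_inP; exists e => //; rewrite (ends_eq ue ve).
Qed.

Lemma mem_cut S e :
  reflect (exists u v, [/\ u \in ends e, v \in ends e, u \in S & v \notin S])
    (e \in cut S).
Proof.
rewrite inE; apply: (iffP andP) => [[/set0Pn[u /setIP[ue uS]]]|].
  by case/subsetPn=> v ve vS; exists u, v.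
case=> u [v [ue ve uS vS]]; split; last by apply/subsetPn; exists v.
by apply/set0Pn; exists u; rewrite inE ue.
Qed.

Lemma conn_cross F S u v : conn F u v -> u \in S -> v \notin S ->
  exists2 e, e \in F & e \in cut S.
Proof.
case/connectP=> p + ->; elim: p u => [|w p IH] u /=; first by move=> _ ->.
case/andP=> /exists_inP[e eF /eqP ee] pp uS lS.
case: (boolP (w \in S)) => wS; first exact: IH pp wS lS.
by exists e => //; apply/mem_cut; exists u, w; rewrite ee !inE !eqxx orbT uS wS.
Qed.

Lemma conn_closed F S u v : (forall e, e \in F -> e \notin cut S) ->
  conn F u v -> u \in S -> v \in S.
Proof.
move=> FS uv uS; apply: contraT => vS.
by have [e eF] := conn_cross uv uS vS; rewrite (negPf (FS e eF)).
Qed.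

Lemma conn_sub F F' u v :
  (forall e x y, e \in F -> x \in ends e -> y \in ends e -> conn F' x y) ->
  conn F u v -> conn F' u v.
Proof.
move=> FF' uv; suff: v \in component F' u by rewrite inE.
apply: (conn_closed _ uv); last by rewrite inE conn_refl.
move=> e eF; apply/mem_cut => -[x [y [xe ye]]]; rewrite !inE => ux /negP; apply.
exact: conn_trans ux (FF' e x y eF xe ye).
Qed.

Lemma conn_mono F F' u v : F \subset F' -> conn F u v -> conn F' u v.
Proof.
move=> /subsetP sFF'; apply: conn_sub => e x y /sFF' eF'.
exact: conn_edge eF'.
Qed.

Lemma mem_comp F u : u \in component F u.
Proof. by rewrite inE conn_refl. Qed.

Lemma comp_edge F u e x y : e \in F -> x \in ends e -> y \in ends e ->
  x \in component F u -> y \in component F u.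
Proof.
by move=> eF xe ye; rewrite !inE => /conn_trans; apply; exact: conn_edge eF _ _.
Qed.

Lemma comp_eq F u v : v \in component F u -> component F v = component F u.
Proof.
rewrite inE => uv; apply/setP=> w; rewrite !inE; apply/idP/idP.
  exact: conn_trans uv.
by apply: conn_trans; rewrite conn_sym.
Qed.

(** A path never leaves the component of its start. Hence deleting an edge that is not inside a
    component does not disconnect it. *)
Lemma conn_comp F u v :
  conn F u v -> conn [set e in F | ends e \subset component F u] u v.
Proof.
move=> uv; set F' := [set e in F | _].
suff: v \in component F' u by rewrite inE.
apply: (conn_closed (S := component F' u) _ uv); last exact: mem_comp.
move=> e eF; apply/mem_cut => -[x [y [xe ye xu /negP]]]; apply.
apply: (comp_edge _ xe ye xu); rewrite inE eF; apply/subsetP => z ze.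
apply: (comp_edge eF xe ze); move: xu; rewrite !inE; apply: conn_mono.
by apply/subsetP => e'; rewrite inE => /andP[].
Qed.

(** Only [b] can lead out of the component of [u] in [F :\ b], and likewise for [v]. The two ends of
    [b] found in this way differ, since a common end would join [u] to [v]. *)
Lemma conn_del F b u v : conn F u v -> ~~ conn (F :\ b) u v ->
  exists p q, [/\ ends b = [set p; q], conn (F :\ b) u p & conn (F :\ b) q v].
Proof.
move=> uv nuv.
have cross w w' : conn F w w' -> ~~ conn (F :\ b) w w' ->
    exists2 p, p \in ends b & conn (F :\ b) w p.
  move=> ww' nww'.
  have [||e eF] := @conn_cross F (component (F :\ b) w) w w' ww'; rewrite ?mem_comp //.
    by rewrite inE.
  case/mem_cut=> x [y [xe ye xw yw]]; exists x; last by rewrite inE in xw.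
  case: (eqVneq e b) => [<-//|eb].
  by case/negP: yw; apply: comp_edge xe ye xw; rewrite !inE eb.
have [p pb up] := cross _ _ uv nuv.
have [||q qb vq] := cross v u; rewrite 1?conn_sym //.
have pq : p != q.
  apply: contraNneq nuv => pq; apply: conn_trans up _.
  by rewrite conn_sym pq.
by exists p, q; split=> //; [exact: ends_eq | rewrite conn_sym].
Qed.

(** If deleting [b] cuts [x] off from both [y] and [z], these two hang on the same end of [b], the
    one away from [x]. *)
Lemma conn_del3 F b x y z : conn F x y -> conn F x z ->
  [|| conn (F :\ b) x y, conn (F :\ b) x z | conn (F :\ b) y z].
Proof.
move=> xy xz; case: (boolP (conn _ x y)) => //= nxy.
case: (boolP (conn _ x z)) => //= nxz.
have [p [q [bpq xp qy]]] := conn_del xy nxy.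
have [p' [q' [bpq' xp' qz]]] := conn_del xz nxz.
have : q' \in ends b by rewrite bpq' !inE eqxx orbT.
rewrite bpq !inE => /orP[]/eqP eq'; subst q'.
  by case/negP: nxz; exact: conn_trans xp qz.
by apply: conn_trans qz; rewrite conn_sym.
Qed.

Lemma touchedP F v :
  reflect (exists2 e, e \in F & v \in ends e) (v \in touched F).
Proof. exact: bigcupP. Qed.

Lemma cut_edge_connected k S : edge_connected k G -> S != set0 -> S != setT ->
  k <= #|cut S|.
Proof.
move=> Gk /set0Pn[u uS] /negP ST; rewrite leqNgt; apply/negP => ltk.
have [_ /(_ u) conG] := Gk _ ltk.
case: ST; rewrite -subTset; apply/subsetP => v _.
apply: (@conn_closed (~: cut S) S u) => // [e|].
  by rewrite inE.
apply: connect_sub (conG v) => x y.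
case/existsP=> e /andP[eF xy].
by apply/connect1/exists_inP; exists e; rewrite ?in_setC.
Qed.

End Connectivity.

(** * Non-separating ears *)

Section Ears.
Variable G : multigraph.
Notation V := (vertex G).
Notation E := (edge G).
Implicit Types (Q R T : {set E}) (S U : {set V}) (s u v x y : V) (e f g : E).

Definition off U Q : {set E} := [set e in Q | [disjoint ends e & U]].
Definition spoke U e s : bool :=
  [&& s \in ends e, s \notin U & ~~ [disjoint ends e & U]].
(** An ear is a chord of [U], or a path or cycle with inner vertices outside [U]: the two spokes may
    share their end in [U], and [s1 = s2] is allowed. *)
Definition ear U Q : bool :=
  [exists g in Q, ends g \subset U] ||
  [exists e1 in Q, exists e2 in Q, exists s1, exists s2,
    [&& e1 != e2, spoke U e1 s1, spoke U e2 s2 & conn (off U Q) s1 s2]].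
Definition connected_edges T : bool :=
  [forall u in touched T, forall v in touched T, conn T u v].

Lemma ear_chord U Q g : g \in Q -> ends g \subset U -> ear U Q.
Proof. by move=> gQ gU; apply/orP; left; apply/exists_inP; exists g. Qed.

Lemma ear_spokes U Q e1 e2 s1 s2 : e1 \in Q -> e2 \in Q -> e1 != e2 ->
  spoke U e1 s1 -> spoke U e2 s2 -> conn (off U Q) s1 s2 -> ear U Q.
Proof.
move=> e1Q e2Q e12 es1 es2 s12; apply/orP; right.
apply/exists_inP; exists e1 => //; apply/exists_inP; exists e2 => //.
by apply/existsP; exists s1; apply/existsP; exists s2; rewrite e12 es1 es2.
Qed.

Lemma off_del U Q f : off U (Q :\ f) = off U Q :\ f.
Proof. by apply/setP => e; rewrite !inE andbA. Qed.

Lemma spokeP U e s : reflect (exists2 u, u \in U &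
    s \notin U /\ ends e = [set u; s]) (spoke U e s).
Proof.
apply: (iffP and3P) => [[se sU /pred0Pn[u /andP[/= ue uU]]]|[u uU [sU ee]]].
  exists u => //; split=> //; apply: ends_eq => //.
  by apply: contraNneq sU => <-.
split=> //; first by rewrite ee !inE eqxx orbT.
by apply/pred0Pn; exists u; rewrite /= uU ee !inE eqxx.
Qed.

Lemma spoke_off U Q e s : spoke U e s -> e \notin off U Q.
Proof. by case/and3P=> _ _ eU; rewrite inE (negPf eU) andbF. Qed.

Lemma comp_off U Q y v : y \notin U -> v \in component (off U Q) y -> v \notin U.
Proof.
rewrite [v \in _]inE -!in_setC => yU yv; apply: (conn_closed _ yv yU) => e.
rewrite inE => /andP[_ eU]; apply/mem_cut => -[x [z [_ ze _]]].
by rewrite in_setC (disjointFr eU ze).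
Qed.

Lemma connected_edgesP T :
  reflect (forall u v, u \in touched T -> v \in touched T -> conn T u v)
    (connected_edges T).
Proof.
apply: (iffP forall_inP) => [H u v /H/forall_inP|H u uT]; first exact.
by apply/forall_inP => v; apply: H.
Qed.

Lemma connected_edges_add T f v : connected_edges T -> f \notin T ->
  v \in ends f -> v \in touched T -> connected_edges (f |: T).
Proof.
move=> /connected_edgesP Tc fT vf vT; apply/connected_edgesP.
suff toV u : u \in touched (f |: T) -> conn (f |: T) v u.
  move=> u w uT wT; apply: conn_trans (toV _ wT).
  by rewrite conn_sym toV.
case/touchedP=> e /setU1P[->|eT] ue; first exact: conn_edge (setU11 _ _) vf ue.
apply: conn_mono (subsetUr _ _) _; apply: Tc => //.
by apply/touchedP; exists e.
Qed.

Hypothesis cut3 : forall S, S != set0 -> S != setT -> 3 <= #|cut S|.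

(** Since [T] misses [S], every edge of [cut S] is a spoke of [R :\: T]. Two of them differ from
    [f], and [S] stays connected without [f], which does not lie inside it. *)
Lemma ear_untouched U R T y f :
  U != set0 -> (forall e, e \notin R -> ends e \subset U) -> y \notin U ->
  let S := component (off U (R :\: T)) y in
  (forall v, v \in S -> v \notin touched T) -> ~~ (ends f \subset S) ->
  ear U ((R :\: T) :\ f).
Proof.
move=> /set0Pn[u0 u0U] RU yU S ST fS; set Q := R :\: T.
have SU v : v \in S -> v \notin U by apply: comp_off.
have yS : y \in S by apply: mem_comp.
have spokeS e : e \in cut S -> e \in Q /\ exists2 s, spoke U e s & s \in S.
  case/mem_cut=> s [x [se xe sS xS]].
  have eQ : e \in Q.
    rewrite inE; apply/andP; split.
      by apply: contraNN (ST s sS) => eT; apply/touchedP; exists e.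
    by apply: contraT => /RU/subsetP/(_ _ se); rewrite (negPf (SU s sS)).
  split=> //; exists s => //; apply/and3P; split=> //; first exact: SU.
  by apply: contraNN xS => eU; apply: (comp_edge _ se xe sS); rewrite inE eQ.
have /card_gt1P[e1 [e2 [+ + e12]]] : 1 < #|cut S :\ f|.
  have := @cut3 S; rewrite (cardsD1 f (cut S)) => cS.
  suff: 3 <= (f \in cut S) + #|cut S :\ f| by case: (_ \in _) => // /ltnW.
  apply: cS; first by apply/set0Pn; exists y.
  by apply: contraTneq u0U => ST0; apply: SU; rewrite ST0.
move=> /setD1P[e1f /spokeS[e1Q [s1 es1 s1S]]].
move=> /setD1P[e2f /spokeS[e2Q [s2 es2 s2S]]].
apply: (ear_spokes (e1 := e1) (e2 := e2)) es1 es2 _ => //.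
- by rewrite in_setD1 e1f.
- by rewrite in_setD1 e2f.
rewrite off_del.
have inS v : v \in S -> conn (off U Q :\ f) y v.
  rewrite inE => /conn_comp; apply: conn_mono; apply/subsetP => e.
  rewrite in_setD1 inE => /andP[-> eS]; rewrite andbT.
  by apply: contraNneq fS => <-.
by apply: conn_trans (inS _ s2S); rewrite conn_sym inS.
Qed.

Section MaximalComplement.
Variables (U : {set V}) (R T : {set E}).
Hypothesis U0 : U != set0.
Hypothesis RU : forall e, e \notin R -> ends e \subset U.
Let Q := R :\: T.
(** This is what maximality of [T] provides: an edge meeting [T] can be moved into [T] without
    disconnecting it, so the move must destroy every ear. *)
Hypothesis essential : forall f v, f \in Q -> v \in ends f -> v \in touched T ->
  ~~ ear U (Q :\ f).
Variables (f0 : E) (v0 : V).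
Hypotheses (f0Q : f0 \in Q) (v0f0 : v0 \in ends f0) (v0T : v0 \in touched T).

Let noear0 : ~~ ear U (Q :\ f0).
Proof. exact: essential v0f0 v0T. Qed.

(** Otherwise [ear_untouched] yields an ear avoiding [f0], which meets [T] at [v0] and so is not
    inside the untouched component. *)
Lemma component_touched y : y \notin U ->
  exists2 v, v \in component (off U Q) y & v \in touched T.
Proof.
move=> yU; apply/exists_inP; apply: contraNT noear0.
rewrite negb_exists => /forallP nT.
have {}nT v : v \in component (off U Q) y -> v \notin touched T.
  by move=> vS; have := nT v; rewrite vS.
apply: (ear_untouched U0 RU yU nT).
by apply: contraTN v0T => /subsetP/(_ _ v0f0)/nT.
Qed.

(* Every component of [Q] off [U] is touched by [T], so it carries an
   essential edge as soon as it carries an edge. *)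
Lemma component_touched_edge e y : e \in Q -> y \in ends e -> y \notin U ->
  exists f v, [/\ f \in Q, v \in ends f, v \in touched T
    & v \in component (off U Q) y /\ (f = e \/ f \in off U Q)].
Proof.
move=> eQ ye yU; have [v vy vT] := component_touched yU.
case: (eqVneq v y) => [vy'|nvy].
  by exists e, v; rewrite vy' in vT vy *; split=> //; split=> //; left.
have yv : conn (off U Q) v y by move: vy; rewrite inE conn_sym.
have [||f fQ] := @conn_cross _ _ [set v] _ _ yv; first exact: set11.
  by rewrite in_set1 eq_sym.
case/mem_cut=> v' [w [vf _ /set1P ev _]]; subst v'.
exists f, v; split=> //; first by move: fQ; rewrite inE => /andP[].
by split=> //; right.
Qed.

(** The chord [g] survives the deletion of any other edge, so [g] is the only edge of [Q] that meets
    [T]. A second chord would be an ear avoiding [g], and an edge leaving [U] would produce another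
    edge meeting [T]. *)
Lemma chord_unique g : g \in Q -> ends g \subset U -> Q = [set g].
Proof.
move=> gQ gU.
have only f v : f \in Q -> v \in ends f -> v \in touched T -> f = g.
  move=> fQ vf vT; apply: contraNeq (essential fQ vf vT) => fg.
  by apply: ear_chord gU; rewrite in_setD1 eq_sym fg.
have ef0 := only _ _ f0Q v0f0 v0T.
apply/eqP; rewrite eqEsubset sub1set gQ andbT; apply/subsetP => e eQ.
rewrite inE; apply: contraNT noear0; rewrite ef0 => eg.
case: (boolP (ends e \subset U)) => [eU|/subsetPn[y ye yU]].
  by apply: ear_chord eU; rewrite in_setD1 eg.
have [f [v [fQ vf vT [_ fe]]]] := component_touched_edge eQ ye yU.
have fg := only _ _ fQ vf vT; case: fe => [fe|]; first by rewrite -fe fg eqxx in eg.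
rewrite fg inE => /andP[_ gU']; have [x xg] := ends_inhabited g.
by have := disjointFr gU' xg; rewrite (subsetP gU _ xg).
Qed.

Section Spokes.
Variables (e1 e2 : E) (s1 s2 : V).
Hypotheses (e1Q : e1 \in Q) (e2Q : e2 \in Q) (e12 : e1 != e2).
Hypotheses (es1 : spoke U e1 s1) (es2 : spoke U e2 s2).
Hypothesis s12 : conn (off U Q) s1 s2.
Let S := component (off U Q) s1.

Let s1S : s1 \in S. Proof. exact: mem_comp. Qed.
Let s2S : s2 \in S. Proof. by rewrite inE. Qed.

Let SU v : v \in S -> v \notin U.
Proof. by apply: comp_off; case/and3P: es1. Qed.

(** Deleting any other edge leaves the ear formed by [e1], [e2] and a path in [S]. *)
Lemma essential_in_ear f v : f \in Q -> v \in ends f -> v \in touched T ->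
  [\/ f = e1, f = e2 | ends f \subset S].
Proof.
move=> fQ vf vT; have := essential fQ vf vT.
case: (eqVneq f e1) => [->|fe1]; first by constructor 1.
case: (eqVneq f e2) => [->|fe2]; first by constructor 2.
case: (boolP (ends f \subset S)) => [|fS]; first by constructor 3.
case/negP; apply: (@ear_spokes _ _ e1 e2 s1 s2) => //.
- by rewrite in_setD1 eq_sym fe1.
- by rewrite in_setD1 eq_sym fe2.
rewrite off_del; have := conn_comp s12; apply: conn_mono; apply/subsetP => e.
rewrite in_setD1 inE => /andP[-> eS]; rewrite andbT.
by apply: contraNneq fS => <-.
Qed.

(** With a third spoke, an ear would survive the deletion of [f0]: if [f0] is a spoke, the other two
    form an ear; if not, two of the three ends in [S] remain joined by [conn_del3]. *)
Lemma two_spokes e s : e \in Q -> s \in S -> spoke U e s -> e = e1 \/ e = e2.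
Proof.
move=> eQ sS es; case: (eqVneq e e1) => [|ne1]; first by left.
case: (eqVneq e e2) => [|ne2]; first by right.
case/negP: noear0.
have s1s : conn (off U Q) s1 s by move: sS; rewrite inE.
have ear_del a b x y : a \in Q -> b \in Q -> a != b -> spoke U a x ->
    spoke U b y -> a != f0 -> b != f0 -> conn (off U Q :\ f0) x y ->
    ear U (Q :\ f0).
  move=> aQ bQ ab ax b_y af bf xy; apply: (@ear_spokes _ _ a b x y) => //.
  - by rewrite in_setD1 af.
  - by rewrite in_setD1 bf.
  by rewrite off_del.
have noff : f0 \notin off U Q -> off U Q :\ f0 = off U Q.
  move=> f0off; apply/setP => x; rewrite in_setD1.
  by case: eqVneq => // ->; rewrite (negPf f0off).
rewrite eq_sym in ne1; rewrite eq_sym in ne2.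
case: (eqVneq e1 f0) => [ef|n1].
  apply: (ear_del e2 e s2 s) => //; rewrite -?ef // 1?eq_sym //.
  rewrite ef noff; first by apply: conn_trans s1s; rewrite conn_sym.
  by rewrite -ef; apply: spoke_off es1.
case: (eqVneq e2 f0) => [ef|n2].
  apply: (ear_del e1 e s1 s) => //; first by rewrite -ef eq_sym.
  by rewrite noff // -ef; apply: spoke_off es2.
case: (eqVneq e f0) => [ef|n3].
  apply: (ear_del e1 e2 s1 s2) => //.
  by rewrite noff // -ef; apply: spoke_off es.
case/or3P: (conn_del3 f0 s12 s1s).
- exact: ear_del e12 es1 es2 n1 n2.
- exact: ear_del ne1 es1 es n1 n3.
- exact: ear_del ne2 es2 es n2 n3.
Qed.

(** If [e] has an end [y] outside both [U] and [S], the component of [y] supplies an edge meeting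
    [T]. Either this is [e], or [essential_in_ear] places it inside [S], which makes that component
    equal to [S]. *)
Lemma ear_edges e : e \in Q -> [\/ e = e1, e = e2 | ends e \subset S].
Proof.
move=> eQ.
case: (boolP (ends e \subset U)) => [eU|/subsetPn[y ye yU]].
  have := f0Q; rewrite (chord_unique eQ eU) => /set1P ef0.
  by apply: essential_in_ear v0T => //; rewrite -ef0.
case: (boolP (y \in S)) => yS.
  case: (boolP [disjoint ends e & U]) => eU; last first.
    have [|->|->] := two_spokes eQ yS; [by apply/and3P| |];
      by [constructor 1 | constructor 2].
  constructor 3; apply/subsetP => z ze; apply: (comp_edge _ ye ze yS).
  by rewrite inE eQ.
have [f [v [fQ vf vT [vy fe]]]] := component_touched_edge eQ ye yU.
case: fe => [fe|foff]; first by apply: essential_in_ear vT; rewrite -?fe.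
case: (essential_in_ear fQ vf vT) => [ff|ff|/subsetP/(_ _ vf) vS].
- by rewrite ff (negPf (spoke_off _ es1)) in foff.
- by rewrite ff (negPf (spoke_off _ es2)) in foff.
by case/negP: yS; rewrite /S -(comp_eq vS) (comp_eq vy) mem_comp.
Qed.

(** Around an untouched vertex [z], three cut edges surround the untouched region, while reaching
    the two spokes from [z] requires only two of them. A third one meets [T], yet its deletion
    spares an ear through [z]. *)
Lemma ear_touched : S \subset touched T.
Proof.
apply/subsetP => z zS; apply: contraT => zT.
(* [D] is the region around [z] that can be explored without meeting [T]. *)
pose F := [set e in off U Q | [disjoint ends e & touched T]].
pose D := component F z.
have FQ : F \subset off U Q by apply/subsetP => e; rewrite inE => /andP[].
have DS v : v \in D -> v \in S.
  rewrite inE => zv; rewrite inE; apply: conn_trans (conn_mono FQ zv).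
  by move: zS; rewrite inE.
have DT v : v \in D -> v \notin touched T.
  rewrite inE -in_setC => zv; apply: (conn_closed _ zv); last by rewrite in_setC.
  move=> e; rewrite inE => /andP[_ eT]; apply/mem_cut => -[x [w [_ we _]]].
  by rewrite in_setC (disjointFr eT we).
have Fcut f : f \in cut D -> F \subset off U Q :\ f.
  move=> /mem_cut[a [b [af bf aD bD]]]; apply/subsetP => e eF.
  rewrite in_setD1 (subsetP FQ) // andbT.
  by apply: contraNneq bD => ef; apply: (comp_edge eF _ _ aD); rewrite ef.
have cutQ f : f \in cut D -> f \in Q.
  case/mem_cut=> a [b [af bf aD bD]]; rewrite inE; apply/andP; split.
    by apply: contraNN (DT a aD) => fT; apply/touchedP; exists f.
  by apply: contraT => /RU/subsetP/(_ _ af); rewrite (negPf (SU (DS _ aD))).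
(* Only one edge of the cut is needed to join [z] to the end of a spoke. *)
have gate e s : spoke U e s -> s \in S -> exists g, forall f,
    f \in cut D -> f != g -> f != e /\ conn (off U Q :\ f) z s.
  move=> es sS; case: (boolP (s \in D)) => sD.
    exists e => f fD fe; split=> //; apply: (conn_mono (Fcut f fD)).
    by move: sD; rewrite inE.
  (* [C] is what [s] reaches without crossing the boundary of [D]; the edge [g] leaving [C] towards
     [z] then ends in [D]. *)
  pose C := component (off U Q :\: cut D) s.
  have CD c : c \in C -> c \notin D.
    rewrite inE -in_setC => sc; apply: (conn_closed _ sc); last by rewrite in_setC.
    move=> f /setDP[_ fD]; apply: contraNN fD => /mem_cut[a [b [af bf]]].
    by rewrite !in_setC negbK => aD bD; apply/mem_cut; exists b, a.
  have sz : conn (off U Q) s z.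
    have := sS; have := zS; rewrite !inE => s1z s1s.
    by apply: conn_trans s1z; rewrite conn_sym.
  have zC : z \notin C by apply/negP => /CD; rewrite mem_comp.
  have [g gQ] := conn_cross sz (mem_comp _ _) zC.
  case/mem_cut=> c [d [cg dg cC dC]].
  have gD : g \in cut D.
    by apply: contraNT dC => gD; apply: (comp_edge _ cg dg cC); rewrite inE gD.
  have dD : d \in D.
    move: gD => /mem_cut[a [b [ag bg aD bD]]].
    have ac : a != c by apply: contraTneq aD => ->; apply: CD.
    move: dg; rewrite (ends_eq ag cg ac) => /set2P[] ed; subst d => //.
    by rewrite cC in dC.
  exists g => f fD fg; split.
    apply: contraTneq fD => ->; apply/mem_cut => -[a [b [ae _ aD _]]].
    have [u uU [_ ee]] := spokeP _ _ _ es.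
    move: ae; rewrite ee !inE => /orP[]/eqP ea; subst a.
      by rewrite (negPf (SU (DS _ aD))) in uU.
    by rewrite aD in sD.
  apply: (@conn_trans _ _ d).
    by apply: (conn_mono (Fcut f fD)); move: dD; rewrite inE.
  apply: (@conn_trans _ _ c).
    by apply: (conn_edge (e := g)) => //; rewrite in_setD1 eq_sym fg.
  rewrite conn_sym; move: cC; rewrite inE; apply: conn_mono; apply/subsetP => e'.
  rewrite inE in_setD1 => /andP[e'D ->]; rewrite andbT.
  by apply: contraNneq e'D => ->.
have [g1 gate1] := gate _ _ es1 s1S; have [g2 gate2] := gate _ _ es2 s2S.
have /subsetPn[f fD] : ~~ (cut D \subset [set g1; g2]).
  have: 3 <= #|cut D|.
    apply: cut3; first by apply/set0Pn; exists z; apply: mem_comp.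
    have [u uU] := set0Pn _ U0; apply: contraTneq uU => DT0.
    by apply/SU/DS; rewrite DT0.
  apply: contraTN => /subset_leq_card cD; rewrite -ltnNge ltnS.
  by apply: leq_trans cD _; rewrite cards2; case: (_ != _).
rewrite in_set2 negb_or => /andP[fg1 fg2].
have [fe1 zs1] := gate1 f fD fg1; have [fe2 zs2] := gate2 f fD fg2.
have fQ := cutQ f fD.
have fS : ends f \subset S.
  by case: (ear_edges fQ) => // ff; rewrite ff eqxx in fe1 fe2.
have foff : f \in off U Q.
  by rewrite inE fQ /= disjoint_subset; apply/subsetP => x /(subsetP fS)/SU.
(* If [f] missed [T] it would belong to [F], and could not leave the component [D]. *)
have [v vf vT] : exists2 v, v \in ends f & v \in touched T.
  apply/exists_inP; apply: contraLR fD => /existsPn fT.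
  have fF : f \in F.
    rewrite inE foff disjoint_subset; apply/subsetP => x xf.
    by have := fT x; rewrite xf.
  by apply/mem_cut => -[a [b [af bf aD /negP]]]; apply; apply: comp_edge aD; eauto.
case/negP: (essential fQ vf vT); apply: (@ear_spokes _ _ e1 e2 s1 s2) => //.
- by rewrite in_setD1 eq_sym fe1.
- by rewrite in_setD1 eq_sym fe2.
by rewrite off_del; apply: conn_trans zs2; rewrite conn_sym.
Qed.

End Spokes.
End MaximalComplement.

(** One step of the decomposition, with [T] a maximal [good] set. The first alternative is the last
    step, when no nonempty connected part of [R] leaves an ear. In the chord case [v] later attaches
    [g] to the connected set built in [T]; in the other case [S \subset touched T] serves this
    purpose. *)
Lemma ear_step U R : U != set0 -> (forall e, e \notin R -> ends e \subset U) ->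
  connected_edges R -> R != set0 ->
  (exists2 g, R = [set g] & ends g \subset U) \/
  exists T, [/\ T \proper R, connected_edges T &
    (exists g, [/\ R :\: T = [set g], ends g \subset U &
       exists2 v, v \in ends g & v \in touched T]) \/
    (exists e1 e2 s1 s2, let S := component (off U (R :\: T)) s1 in
      [/\ [/\ e1 \in R :\: T, e2 \in R :\: T & e1 != e2],
          [/\ spoke U e1 s1, spoke U e2 s2 & s2 \in S],
          S \subset touched T &
          forall e, e \in R :\: T -> [\/ e = e1, e = e2 | ends e \subset S]])].
Proof.
move=> U0 RU Rc /set0Pn[g gR].
pose good T := [&& T \subset R, T != set0, connected_edges T & ear U (R :\: T)].
case: (pickP good) => [T0 T0good|nogood]; last first.
  (* A single edge is connected, so as no set is [good], every edge of [R] lies on all ears of [R].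
     This forces [U] to contain all vertices, and then every edge is a chord. *)
  have noear f : f \in R -> ~~ ear U (R :\ f).
    move=> fR; apply: contraFN (nogood [set f]) => fear; apply/and4P; split=> //.
    - by rewrite sub1set.
    - by apply/set0Pn; exists f; rewrite inE.
    apply/connected_edgesP => u v; rewrite /touched !big_set1.
    exact: conn_edge (set11 f).
  have UT : U = setT.
    apply/eqP; rewrite -subTset; apply/subsetP => y _; apply: contraT => yU.
    pose S := component (off U (R :\: set0)) y.
    have SU v : v \in S -> v \notin U by apply: comp_off.
    have : 0 < #|cut S|.
      apply: (@leq_trans 3) => //; apply: cut3.
        by apply/set0Pn; exists y; apply: mem_comp.
      have [u uU] := set0Pn _ U0; apply: contraTneq uU => ST.
      by apply: SU; rewrite ST.
    case/card_gt0P=> f /mem_cut[a [b [af bf aS bS]]].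
    have fR : f \in R.
      by apply: contraT => /RU/subsetP/(_ _ af); rewrite (negPf (SU _ aS)).
    case/negP: (noear _ fR).
    have := @ear_untouched U R set0 y f U0 RU yU; rewrite setD0; apply.
      by move=> v _; rewrite /touched big_set0 inE.
    by apply/subsetPn; exists b; rewrite // -(setD0 R).
  left; exists g; last by rewrite UT subsetT.
  apply/eqP; rewrite eqEsubset sub1set gR andbT; apply/subsetP => e eR.
  rewrite inE; apply: contraNT (noear _ gR) => eg.
  by apply: (ear_chord (g := e)); rewrite ?UT ?subsetT // in_setD1 eg.
have [T /maxsetP[/and4P[TR T0n Tc Tear] Tmax] _] := maxset_exists T0good.
right; exists T; set Q := R :\: T.
have essential f v : f \in Q -> v \in ends f -> v \in touched T ->
    ~~ ear U (Q :\ f).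
  case/setDP=> fR fT vf vT; apply/negP => fear.
  move/negP: (fT); apply; suff <- : f |: T = T by apply: setU11.
  apply: Tmax (subsetUr _ _); apply/and4P; split.
  - by rewrite subUset sub1set fR.
  - by apply/set0Pn; exists f; rewrite setU11.
  - exact: connected_edges_add vT.
  by rewrite setUC -setDDl.
have Q0 : exists q, q \in Q.
  case/orP: Tear => [/exists_inP[q qQ _]|/exists_inP[q qQ _]]; by exists q.
have TpR : T \proper R.
  case: Q0 => q /setDP[qR qT]; rewrite properE TR.
  by apply/subsetPn; exists q.
have [f0 [v0 [f0Q v0f0 v0T]]] :
    exists f v, [/\ f \in Q, v \in ends f & v \in touched T].
  have [q qQ] := Q0; have [t tT] := set0Pn _ T0n.
  have [a aq] := ends_inhabited q; have [b bt] := ends_inhabited t.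
  have bT : b \in touched T by apply/touchedP; exists t.
  case: (boolP (a \in touched T)) => aT; first by exists q, a.
  have [] := @conn_cross _ R (touched T) b a => //.
    move/connected_edgesP: Rc; apply; apply/touchedP; last first.
      by exists q => //; case/setDP: qQ.
    by exists t => //; apply: subsetP tT.
  move=> f fR /mem_cut[x [y [xf yf xT yT]]]; exists f, x; split=> //.
  by rewrite inE fR andbT; apply: contraNN yT => fT; apply/touchedP; exists f.
split=> //; case/orP: Tear => [/exists_inP[h hQ hU]|].
  left; exists h; have Qh := chord_unique U0 RU essential f0Q v0f0 v0T hQ hU.
  split=> //; exists v0 => //; by move: f0Q; rewrite /Q Qh => /set1P <-.
case/exists_inP=> e1 e1Q /exists_inP[e2 e2Q /existsP[s1 /existsP[s2 /and4P[]]]].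
move=> e12 es1 es2 s12; right; exists e1, e2, s1, s2; split=> //.
- by split=> //; rewrite inE.
- exact: (ear_touched U0 RU essential f0Q v0f0 v0T e1Q e2Q e12 es1 es2 s12).
exact: (ear_edges U0 RU essential f0Q v0f0 v0T e1Q e2Q e12 es1 es2 s12).
Qed.

End Ears.

(** * Two disjoint connected spanning edge sets *)

Section ConnectedPartition.
Variable G : multigraph.
Notation V := (vertex G).
Notation E := (edge G).
Implicit Types (F X Y B : {set E}) (u v x y : V) (e f b : E) (W : {set V}).

(** Loose edges are the non-bridges of [F], that is, those on a cycle of [F]. *)
Definition loose F e : bool := (e \in F) &&
  [forall x in ends e, forall y in ends e, conn (F :\ e) x y].

Lemma looseP F e : reflect (e \in F /\
  forall x y, x \in ends e -> y \in ends e -> conn (F :\ e) x y) (loose F e).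
Proof.
apply: (iffP andP) => -[eF H]; split=> //.
  by move=> x y xe; move: y; apply/forall_inP; move: x xe; apply/forall_inP.
by apply/forall_inP => x xe; apply/forall_inP => y; apply: H.
Qed.

(** A minimal subset of [F :\ e] joining the ends of [e] is a path. It closes a cycle with [e], so
    all its edges are loose. *)
Lemma loose_conn F e x y : loose F e -> x \in ends e -> y \in ends e ->
  conn [set f in F :\ e | loose F f] x y.
Proof.
case/looseP=> eF eF' xe ye.
pose P Y := (Y \subset F :\ e) && conn Y x y.
have PF : P (F :\ e) by rewrite /P subxx eF'.
have [Y /minsetP[/andP[YF Yxy] Ymin] _] := minset_exists PF.
apply: (conn_mono _ Yxy); apply/subsetP => b bY.
have bF := subsetP YF _ bY; rewrite inE bF; have [be bF'] := setD1P bF.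
have nxy : ~~ conn (Y :\ b) x y.
  apply/negP => bxy; have := setD11 b Y; rewrite (Ymin (Y :\ b)) ?bY ?subsetDl //.
  by rewrite /P bxy (subset_trans (subsetDl _ _) YF).
have [p [q [bE xp qy]]] := conn_del Yxy nxy.
have YbF : Y :\ b \subset F :\ b.
  by apply: setSD; apply: subset_trans YF (subsetDl _ _).
have pq : conn (F :\ b) p q.
  apply: (@conn_trans _ _ x); first by rewrite conn_sym (conn_mono YbF).
  apply: (@conn_trans _ _ y); last by rewrite conn_sym (conn_mono YbF).
  by apply: (conn_edge (e := e)); rewrite // in_setD1 eq_sym be.
apply/looseP; split=> // z w; rewrite bE => /set2P[]-> /set2P[]-> //;
  by rewrite ?conn_refl // conn_sym.
Qed.

Definition components F : {set {set V}} := [set component F u | u in V].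

(** [merge] maps the components of [F] onto those of [b |: F], and stays onto once the component of
    [x] is dropped, because that of [y] has the same image. *)
Lemma components_add F b x y : x \in ends b -> y \in ends b -> ~~ conn F x y ->
  #|components (b |: F)| < #|components F|.
Proof.
move=> xb yb nxy; pose merge W := \bigcup_(u in W) component (b |: F) u.
have FbF : F \subset b |: F by apply: subsetUr.
have mergeE u : merge (component F u) = component (b |: F) u.
  apply/setP => v; apply/bigcupP/idP => [[w]|uv]; last first.
    by exists u => //; apply: mem_comp.
  rewrite !inE => /(conn_mono FbF); apply: conn_trans.
have xy : component (b |: F) x = component (b |: F) y.
  apply: comp_eq; apply: (comp_edge (setU11 b F) yb xb); exact: mem_comp.
have neq : component F x != component F y.
  by apply: contraNneq nxy => eq_xy; have := mem_comp F y; rewrite -eq_xy inE.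
rewrite (cardsD1 (component F x) (components F)) imset_f // add1n ltnS.
apply: leq_trans (leq_imset_card merge _); apply: subset_leq_card.
apply/subsetP => _ /imsetP[u _ ->]; apply/imsetP.
case: (eqVneq (component F u) (component F x)) => [ux|nux].
  exists (component F y); first by rewrite in_setD1 eq_sym neq imset_f.
  by rewrite mergeE -xy -!mergeE ux.
by exists (component F u); rewrite ?mergeE // in_setD1 nux imset_f.
Qed.

(** After contraction of the components of [F], the bridges in [B] form a forest. The induction
    moves one bridge from [B] to [F], which merges two components. *)
Lemma card_bridges F B u0 : [disjoint B & F] ->
  (forall b, b \in B -> ~~ loose (B :|: F) b) -> #|B| < #|components F|.
Proof.
have [n] := ubnP #|B|; elim: n B F => // n IH B F Bn BF Bloose.
case: (set_0Vmem B) => [->|[b bB]].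
  by rewrite cards0 card_gt0; apply/set0Pn; exists (component F u0); apply: imset_f.
have BE : B = b |: (B :\ b) by rewrite setD1K.
have bF : b \notin F by rewrite (disjointFr BF bB).
have /forall_inPn[x xb /forall_inPn[y yb nxy]] :
    ~~ [forall x in ends b, forall y in ends b, conn F x y].
  apply: contraNN (Bloose b bB) => /forall_inP H; apply/looseP.
  rewrite inE bB; split=> // x y xb yb; have /forall_inP/(_ _ yb) := H x xb.
  apply: conn_mono; apply/subsetP => e eF; rewrite in_setD1 inE eF orbT andbT.
  by apply: contraNneq bF => <-.
apply: leq_trans (components_add xb yb nxy); rewrite (cardsD1 b B) bB add1n.
rewrite ltnS; apply: IH.
- by move: Bn; rewrite (cardsD1 b B) bB add1n ltnS.
- rewrite disjoints_subset; apply/subsetP => e /setD1P[eb eB].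
  by rewrite !inE negb_or eb (disjointFr BF eB).
- move=> e /setD1P[_ eB]; rewrite setUA [_ :|: [set b]]setUC -BE.
  exact: Bloose.
Qed.

Definition free X e := loose X e || loose (~: X) e.
Definition toggle X e := if e \in X then X :\ e else e |: X.
(** The potential to be maximised over partitions into [X] and its complement. *)
Definition weight X : nat :=
  #|[set p : V * V | conn X p.1 p.2]| + #|[set p : V * V | conn (~: X) p.1 p.2]|.

Lemma setCU1 e X : ~: (e |: X) = ~: X :\ e.
Proof. by apply/setP => f; rewrite !inE negb_or. Qed.

Lemma setCD1 e X : ~: (X :\ e) = e |: ~: X.
Proof. by apply/setP => f; rewrite !inE negb_and negbK. Qed.

Lemma toggleC X e : toggle (~: X) e = ~: toggle X e.
Proof. by rewrite /toggle inE; case: (e \in X); rewrite /= (setCU1, setCD1). Qed.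

Lemma freeC X e : free (~: X) e = free X e.
Proof. by rewrite /free setCK orbC. Qed.

Lemma weightC X : weight (~: X) = weight X.
Proof. by rewrite /weight setCK addnC. Qed.

(** Moving a loose edge loses no connection in its old part. By maximality it gains none in the new
    part, so its ends were already joined there. *)
Lemma weight_toggle X e : (forall Y, weight Y <= weight X) -> free X e ->
  weight (toggle X e) = weight X /\
  forall x y, x \in ends e -> y \in ends e ->
    conn (X :\ e) x y /\ conn (~: X :\ e) x y.
Proof.
wlog eX : X / e \in X.
  move=> H Xmax Xe; case: (boolP (e \in X)) => eX; first exact: H.
  have [|||w c] := H (~: X).
  - by rewrite inE.
  - by move=> Y; rewrite weightC.
  - by rewrite freeC.
  move: w; rewrite toggleC !weightC => w; split=> // x y xe ye.
  by have := c x y xe ye; rewrite setCK => -[].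
move=> Xmax /orP[/looseP[_ eloose]|/andP[]]; last by rewrite inE eX.
pose pairs F := [set p : V * V | conn F p.1 p.2].
have pairs_mono F F' : F \subset F' -> pairs F \subset pairs F'.
  by move=> FF'; apply/subsetP => p; rewrite !inE; apply: conn_mono.
have pX : pairs (X :\ e) = pairs X.
  apply/eqP; rewrite eqEsubset pairs_mono ?subsetDl //=.
  apply/subsetP => p; rewrite !inE; apply: conn_sub => f x y fX xf yf.
  case: (eqVneq f e) => [fe|fe]; first by apply: eloose; rewrite -fe.
  by apply: (conn_edge (e := f)); rewrite // in_setD1 fe.
have pC : pairs (~: X) \subset pairs (e |: ~: X) by apply: pairs_mono; apply: subsetUr.
have := Xmax (toggle X e).
rewrite /toggle eX /weight setCD1 -!/(pairs _) pX leq_add2l => le.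
have pE : pairs (~: X) = pairs (e |: ~: X) by apply/eqP; rewrite eqEcard pC.
rewrite pE; split=> // x y xe ye; split; first exact: eloose.
have : (x, y) \in pairs (e |: ~: X).
  by rewrite inE /=; apply: conn_edge xe ye; apply: setU11.
rewrite -pE inE; congr (conn _ x y); apply/setP => f; rewrite !inE.
by case: eqVneq => // ->; rewrite eX.
Qed.

(* [freed] collects the edges that become redundant in their part after some
   sequence of exchanges. Both parts already connect inside [freed] whatever
   [freed] connects, and every other edge is a bridge of its part; comparing
   with the cuts around the components of [freed] shows that it is connected. *)
Section MaximalPartition.
Variable X0 : {set E}.
Hypothesis X0max : forall Y, weight Y <= weight X0.

Definition toggle_step : rel {set E} :=
  fun X Y => [exists e, free X e && (Y == toggle X e)].
Definition freed : {set E} :=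
  [set e | [exists X, connect toggle_step X0 X && free X e]].

Lemma mem_freed X e : connect toggle_step X0 X -> free X e -> e \in freed.
Proof. by move=> X0X Xe; rewrite inE; apply/existsP; exists X; rewrite X0X. Qed.

Lemma reach_toggle X e : connect toggle_step X0 X -> free X e ->
  connect toggle_step X0 (toggle X e).
Proof.
move=> X0X Xe; apply: connect_trans X0X (connect1 _).
by apply/existsP; exists e; rewrite Xe eqxx.
Qed.

Lemma reach_max X : connect toggle_step X0 X -> forall Y, weight Y <= weight X.
Proof.
case/connectP=> p + ->; move: X0max; elim: p X0 => //= X1 p IH Z Zmax.
case/andP=> /existsP[e /andP[Ze /eqP ->]]; apply: IH => Y.
by have [-> _] := weight_toggle Zmax Ze.
Qed.

(** Placing [e] in either part gives a reachable partition, in which [e] is loose by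
    [weight_toggle]. The other edges of a cycle through it are loose as well, hence in [freed]. *)
Lemma free_conn X e x y : connect toggle_step X0 X -> free X e ->
  x \in ends e -> y \in ends e ->
  conn (X :&: freed) x y /\ conn (~: X :&: freed) x y.
Proof.
move=> X0X Xe xe ye.
have [_ Xconn] := weight_toggle (reach_max X0X) Xe.
have setU1D F : (e |: F) :\ e = F :\ e.
  by apply/setP => f; rewrite !inE; case: eqVneq.
have looseU F : (forall z w, z \in ends e -> w \in ends e -> conn (F :\ e) z w) ->
    loose (e |: F) e.
  move=> eF; apply/looseP; split; first exact: setU11.
  by move=> z w ze we; rewrite setU1D eF.
have sub F : (forall f, loose (e |: F) f -> f \in freed) ->
    [set f in (e |: F) :\ e | loose (e |: F) f] \subset F :&: freed.
  move=> Fl; apply/subsetP => f; rewrite !inE.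
  case/andP=> /andP[/negPf -> /= fF] /Fl; rewrite inE => ->.
  by rewrite fF.
split.
- apply: conn_mono (loose_conn (looseU X _) xe ye).
    apply: sub => f fl; apply: (@mem_freed (e |: X)); last by rewrite /free fl.
    have := reach_toggle X0X Xe; rewrite /toggle.
    by case: ifP => // eX _; rewrite (setUidPr _) // sub1set.
  by move=> z w ze we; have [] := Xconn z w ze we.
- apply: conn_mono (loose_conn (looseU (~: X) _) xe ye).
    apply: sub => f fl; apply: (@mem_freed (X :\ e)).
      have := reach_toggle X0X Xe; rewrite /toggle; case: ifP => // eX _.
      by rewrite (setDidPl _) // disjoint_sym disjoints1 eX.
    by rewrite /free setCD1 fl orbT.
  by move=> z w ze we; have [] := Xconn z w ze we.
Qed.

(** Walking the exchanges backwards, the exchanged edge is replaced by the path that [free_conn]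
    gives in the earlier partition. *)
Lemma reach_conn X u v : connect toggle_step X0 X ->
  (conn (X :&: freed) u v -> conn (X0 :&: freed) u v) /\
  (conn (~: X :&: freed) u v -> conn (~: X0 :&: freed) u v).
Proof.
suff H p Y : connect toggle_step X0 Y -> path toggle_step Y p ->
    (conn (last Y p :&: freed) u v -> conn (Y :&: freed) u v) /\
    (conn (~: last Y p :&: freed) u v -> conn (~: Y :&: freed) u v).
  by case/connectP=> p pP ->; apply: H pP; apply: connect0.
elim: p Y => //= X1 p IH Y X0Y /andP[/existsP[e /andP[Ye /eqP ->]] pP].
have [IH1 IH2] := IH _ (reach_toggle X0Y Ye) pP.
have back F F' : (forall x y, x \in ends e -> y \in ends e ->
      conn (F' :&: freed) x y) ->
    (forall f, f \in F -> f != e -> f \in F') ->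
    conn (F :&: freed) u v -> conn (F' :&: freed) u v.
  move=> eF' FF'; apply: conn_sub => f x y /setIP[fF ffr] xf yf.
  case: (eqVneq f e) => [fe|fe]; first by apply: eF'; rewrite -fe.
  by apply: (conn_edge (e := f)); rewrite // inE FF'.
split=> [/IH1|/IH2]; apply: back.
- by move=> x y xe ye; have [] := free_conn X0Y Ye xe ye.
- by move=> f; rewrite /toggle; case: ifP => _; rewrite !inE => + /negPf fe; rewrite fe.
- by move=> x y xe ye; have [] := free_conn X0Y Ye xe ye.
- by move=> f; rewrite /toggle; case: ifP => _; rewrite !inE => + /negPf fe; rewrite fe.
Qed.

Lemma freed_conn u v : conn freed u v ->
  conn (X0 :&: freed) u v /\ conn (~: X0 :&: freed) u v.
Proof.
move=> uv; split; apply: conn_sub uv => e x y;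
  rewrite inE => /existsP[X /andP[X0X Xe]] xe ye;
  have [c1 c2] := free_conn X0X Xe xe ye;
  by have [i1 i2] := reach_conn x y X0X; auto.
Qed.

(** In each part, [freed] has the same components as the whole of [freed], and the remaining edges
    are bridges; [card_bridges] is applied to both parts. *)
Lemma card_unfreed u0 : #|~: freed|.+2 <= #|components freed|.*2.
Proof.
have comps F : F \subset freed -> (forall u v, conn freed u v -> conn F u v) ->
    components F = components freed.
  move=> Ff fF; apply: eq_imset => u; apply/setP => v; rewrite !inE.
  by apply/idP/idP; [apply: conn_mono | apply: fF].
have bridges F : (forall f, loose F f -> free X0 f) ->
    (forall u v, conn freed u v -> conn (F :&: freed) u v) ->
    #|F :\: freed| < #|components freed|.
  move=> Ff fF; rewrite -(comps (F :&: freed) (subsetIr _ _) fF).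
  apply: card_bridges u0 _ _.
    rewrite disjoints_subset; apply/subsetP => e /setDP[_ efr].
    by rewrite in_setC in_setI (negPf efr) andbF.
  move=> b /setDP[bF]; apply: contraNN; rewrite setUC setID => /Ff.
  exact: mem_freed (connect0 _ _).
have -> : #|~: freed| = #|X0 :\: freed| + #|~: X0 :\: freed|.
  rewrite -(cardsID X0 (~: freed)); congr (_ + _); apply: eq_card => e;
  by rewrite !inE andbC.
have b1 := bridges X0; have b2 := bridges (~: X0).
rewrite -addnn -addSn -addnS leq_add //.
- apply: b1 => [f fl|u v /freed_conn[]//]; by rewrite /free fl.
- apply: b2 => [f fl|u v /freed_conn[]//]; by rewrite /free fl orbT.
Qed.

End MaximalPartition.

(** Double counting: an edge of [F] lies in no such cut, any other edge only in those of the
    components of its two ends. *)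
Lemma sum_cut_components F :
  \sum_(W in components F) #|cut W| <= #|~: F|.*2.
Proof.
under eq_bigr => W _ do rewrite -sum1_card big_mkcond /=.
rewrite exchange_big /= -muln2 -sum_nat_const [leqRHS]big_mkcond /=.
apply: leq_sum => e _; rewrite -big_mkcondr sum1_card in_setC.
case: (boolP (e \in F)) => /= eF.
  rewrite leqn0; apply/eqP/eq_card0 => W; apply/negP.
  rewrite unfold_in => /andP[/imsetP[u _ ->] /mem_cut[x [y [xe ye xW /negP]]]].
  by apply; apply: comp_edge xW; eauto.
have [x [y [xy eE]]] := endsP e.
apply: (@leq_trans #|[set component F x; component F y]|); last first.
  by rewrite cards2; case: (_ != _).
apply: subset_leq_card; apply/subsetP => W.
rewrite unfold_in => /andP[/imsetP[u _ ->] /mem_cut[z [_ [ze _ zW _]]]].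
by move: ze; rewrite -(comp_eq zW) eE => /set2P[]->; [apply: set21 | apply: set22].
Qed.

Lemma connected_partition : edge_connected 4 G -> exists X,
  (forall u v, conn X u v) /\ (forall u v, conn (~: X) u v).
Proof.
move=> G4.
have [X _ Xmax] := @arg_maxnP _ set0 xpredT weight isT.
have {}Xmax Y : weight Y <= weight X by apply: Xmax.
have fr u v : conn (freed X) u v.
  apply: contraT => nuv.
  have := card_unfreed Xmax u; have := sum_cut_components (freed X).
  set p := #|components _|; set q := #|~: _|.
  (* If [freed] is disconnected, then [4 p <= 2 q] by the cuts, against [q + 2 <= 2 p] from
     [card_unfreed]. *)
  suff le4 : p * 4 <= \sum_(W in components (freed X)) #|cut W|.
    by move=> /(leq_trans le4); rewrite -!muln2; lia.
  rewrite -sum_nat_const; apply: leq_sum => _ /imsetP[w _ ->].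
  apply: cut_edge_connected G4 _ _; first by apply/set0Pn; exists w; apply: mem_comp.
  apply: contraNneq nuv => wT.
  have : u \in component (freed X) w by rewrite wT.
  have : v \in component (freed X) w by rewrite wT.
  by rewrite !inE => wv wu; apply: conn_trans wv; rewrite conn_sym.
by exists X; split=> u v; have [c1 c2] := freed_conn Xmax (fr u v);
  [apply: conn_mono c1 | apply: conn_mono c2]; apply: subsetIl.
Qed.

End ConnectedPartition.

Local Open Scope ring_scope.

(** * Integer flows *)

Section IntegerFlows.
Variables (G : multigraph) (D : orientation G).
Notation V := (vertex G).
Notation E := (edge G).
Implicit Types (F X R T : {set E}) (S U : {set V}) (s u v w : V) (e : E).
Implicit Types (phi psi : E -> int).

Definition incidence e v : int := (tail D e == v)%:Z - (Defs.head D e == v)%:Z.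
Definition excess phi v : int := \sum_e phi e * incidence e v.

Lemma excessD phi psi v :
  excess (fun e => phi e + psi e) v = excess phi v + excess psi v.
Proof. by rewrite -big_split; apply: eq_bigr => e _; rewrite mulrDl. Qed.

Lemma excessZ c phi v : excess (fun e => c * phi e) v = c * excess phi v.
Proof. by rewrite big_distrr; apply: eq_bigr => e _; rewrite /= mulrA. Qed.

Lemma excess_single c e v :
  excess (fun f => c * (f == e)%:Z) v = c * incidence e v.
Proof.
rewrite /excess (bigD1 e) //= eqxx mulr1 big1 ?addr0 // => f /negPf ->.
by rewrite mulr0 mul0r.
Qed.

(** The sign [c] absorbs the orientation of [e], so that units can be routed along undirected
    paths. *)
Lemma excess_edge e u w : u != w -> ends e = [set u; w] ->
  exists2 c : int, c = 1 \/ c = -1 &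
    forall v, excess (fun f => c * (f == e)%:Z) v = (u == v)%:Z - (w == v)%:Z.
Proof.
move=> uw eE.
have : Defs.head D e \in [set u; w] by rewrite -eE (tail_headE D) !inE eqxx orbT.
have : tail D e \in [set u; w] by rewrite -eE (tail_headE D) !inE eqxx.
have : tail D e != Defs.head D e.
  have := card_ends e; rewrite (tail_headE D) cards2.
  by case: (_ != _).
rewrite !inE => th /orP[]/eqP te /orP[]/eqP he; rewrite te he ?eqxx // in th.
  by exists 1 => [|v]; [left | rewrite excess_single mul1r /incidence te he].
by exists (-1) => [|v]; [right | rewrite excess_single mulN1r /incidence te he opprB].
Qed.

Lemma unit_flow F u w : conn F u w -> exists2 phi : E -> int,
  forall e, e \notin F -> phi e = 0 &
  forall v, excess phi v = (u == v)%:Z - (w == v)%:Z.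
Proof.
case/connectP=> p + ->; elim: p u => [|x p IH] u /=.
  exists (fun=> 0) => // v; rewrite subrr /excess big1 // => e _.
  by rewrite mul0r.
case/andP=> /exists_inP[e eF /eqP eE] /IH[phi phiF phiE].
have ux : u != x by have := card_ends e; rewrite eE cards2; case: (_ != _).
have [c _ cE] := excess_edge ux eE.
exists (fun f => c * (f == e)%:Z + phi f) => [f fF|v].
  rewrite phiF // (_ : (f == e) = false) ?mulr0 //.
  by apply: contraNF fF => /eqP ->.
by rewrite excessD cE phiE addrA subrK.
Qed.

(** Each edge [e] outside [X] closes a circulation with a path in [X]; these are combined with
    coefficients [p e]. *)
Lemma flow_prescribed X (p : E -> int) : (forall u v, conn X u v) ->
  exists2 psi : E -> int, forall v, excess psi v = 0 &
    forall e, e \notin X -> psi e = p e.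
Proof.
move=> Xc.
have /fin_all_exists[psi psiP] e : exists psi : {ffun E -> int},
    (forall v, excess psi v = 0) /\
    forall f, f \notin X -> psi f = (f == e)%:Z.
  case: (boolP (e \in X)) => eX.
    exists [ffun=> 0]; split=> [v|f fX].
      by rewrite /excess big1 // => f _; rewrite ffunE mul0r.
    by rewrite ffunE (_ : (f == e) = false) //; apply: contraNF fX => /eqP ->.
  have [phi phiX phiE] := unit_flow (Xc (Defs.head D e) (tail D e)).
  exists [ffun f => (f == e)%:Z + phi f]; split=> [v|f fX]; last first.
    by rewrite ffunE phiX ?addr0.
  under [LHS]eq_bigr => f _ do rewrite ffunE.
  rewrite -/(excess (fun f => (f == e)%:Z + phi f) v) excessD phiE.
  rewrite /excess (bigD1 e) //= eqxx mul1r big1 => [|f /negPf -> //].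
    by rewrite /incidence; lia.
  by rewrite mul0r.
exists (fun f => \sum_e p e * psi e f) => [v|f fX].
  rewrite /excess; under eq_bigr => f _ do rewrite big_distrl /=.
  rewrite exchange_big big1 // => e _; have [+ _] := psiP e => /(_ v).
  move/(congr1 (fun x => p e * x)); rewrite mulr0 big_distrr /= => {2}<-.
  by apply: eq_bigr => f _; rewrite mulrA.
rewrite (bigD1 f) //= (proj2 (psiP f)) // eqxx mulr1 big1 ?addr0 // => e ef.
by rewrite (proj2 (psiP e)) // eq_sym (negPf ef) mulr0.
Qed.

(** Each condition excludes a single residue of [k] modulo 3, so one of 0, 1 and -1 remains. *)
Lemma avoid_mod3 (a b c d : int) : c = 1 \/ c = -1 -> d = 1 \/ d = -1 ->
  exists k : int, ~~ (3 %| a + k * c)%Z /\ ~~ (3 %| b + k * d)%Z.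
Proof.
have one_bad (x y : int) : y = 1 \/ y = -1 ->
    [/\ (3 %| x)%Z -> ~~ (3 %| x + y)%Z, (3 %| x)%Z -> ~~ (3 %| x - y)%Z &
        (3 %| x + y)%Z -> ~~ (3 %| x - y)%Z].
  by case=> ->; split; lia.
move=> /(one_bad a)[a1 a2 a3] /(one_bad b)[b1 b2 b3].
case: (boolP ((3 %| a)%Z || (3 %| b)%Z)) => [|/norP[]]; last first.
  by exists 0; rewrite !mul0r !addr0.
case: (boolP ((3 %| a + c)%Z || (3 %| b + d)%Z)) => [|/norP[]]; last first.
  by exists 1; rewrite !mul1r.
move=> ab1 ab0; exists (-1); rewrite !mulN1r.
by case/orP: ab1 => [x1|x1]; case/orP: ab0 => x0; split; auto;
  by [rewrite (negPf (a1 _)) in x1 | rewrite (negPf (b1 _)) in x1].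
Qed.

Hypothesis cut3 : forall S, S != set0 -> S != setT -> (3 <= #|cut S|)%N.

(** Induction along the ears. The circulation through the current ear returns through removed edges
    and vanishes on [T], so a multiple of it repairs the new edges of [X] without disturbing those
    in [T]. *)
Lemma connected_mod3_flow_rec n U R : (#|R| <= n)%N -> U != set0 ->
  (forall e, e \notin R -> ends e \subset U) ->
  (forall u v, u \in U -> v \in U -> conn (~: R) u v) -> connected_edges R ->
  exists X, [/\ X \subset R,
    forall u v, u \in touched R -> v \in touched R -> conn X u v &
    forall g : E -> int, exists2 phi : E -> int, forall v, excess phi v = 0 &
      forall e, e \in X -> ~~ (3 %| g e + phi e)%Z].
Proof.
elim: n U R => [|n IH] U R Rn U0 RU UR Rc.
  have R0 : R = set0 by apply/eqP; rewrite -cards_eq0; lia.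
  exists set0; split=> [|u v|g]; first exact: sub0set.
    by rewrite R0 /touched big_set0 inE.
  exists (fun=> 0) => [v|e]; last by rewrite inE.
  by rewrite /excess big1 // => e _; rewrite mul0r.
case: (eqVneq R set0) => [R0|R0].
  by apply: (IH U R) => //; rewrite R0 cards0.
(* One more chord [g] of [U] is dealt with by a multiple of the circulation
   through [g] and the edges already removed from [R]. *)
have chord T X g : T \subset R -> g \in R :\: T -> ends g \subset U ->
    X \subset T ->
    (forall h : E -> int, exists2 phi : E -> int, forall v, excess phi v = 0 &
      forall e, e \in X -> ~~ (3 %| h e + phi e)%Z) ->
    forall h : E -> int, exists2 phi : E -> int, forall v, excess phi v = 0 &
      forall e, e \in g |: X -> ~~ (3 %| h e + phi e)%Z.
  move=> TR /setDP[gR gT] gU XT XP h; have [phi phi0 phiX] := XP h.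
  have [a [b [ab gE]]] := endsP g.
  have [c c1 cE] := excess_edge ab gE.
  have [|psi psiR psiE] := @unit_flow (~: R) b a.
    by apply: UR; apply: (subsetP gU); rewrite gE !inE eqxx ?orbT.
  have [k [kP _]] := avoid_mod3 (h g + phi g) 0 c1 c1.
  exists (fun e => phi e + k * (c * (e == g)%:Z + psi e)) => [v|e].
    by rewrite excessD excessZ excessD phi0 cE psiE; ring.
  have psi0 : e \in R -> psi e = 0 by move=> eR; apply: psiR; rewrite inE negbK.
  case/setU1P=> [->|eX]; first by rewrite eqxx psiR ?inE ?gR // mulr1 addr0 addrA.
  have eT := subsetP XT _ eX.
  rewrite psi0 ?(subsetP TR) // (_ : (e == g) = false).
    by rewrite mulr0 addr0 mulr0 addr0 phiX.
  by apply: contraNF gT => /eqP <-.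
have [[g Rg gU]|[T [TpR Tc Tcase]]] := ear_step cut3 U0 RU Rc R0.
  exists [set g]; split=> [|u v|].
  - by rewrite Rg.
  - by rewrite Rg /touched big_set1; apply: conn_edge (set11 g).
  - rewrite -(setU0 [set g]); apply: (chord set0) => //; rewrite ?sub0set //.
      by rewrite setD0 Rg set11.
    move=> h; exists (fun=> 0) => [v|e]; last by rewrite inE.
    by rewrite /excess big1 // => e _; rewrite mul0r.
have [TR _] := andP TpR.
have Tn : (#|T| <= n)%N by rewrite -ltnS (leq_trans (proper_card TpR)).
have RTsub : ~: R \subset ~: T by rewrite setCS.
case: Tcase => [[g [Qg gU [v0 v0g v0T]]]|].
  have gQ : g \in R :\: T by rewrite Qg set11.
  have RE : R = g |: T by rewrite -Qg setUC -{1}(setID R T) (setIidPr TR).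
  have [||X [XT Xc XP]] := IH U T Tn U0 _ _ Tc.
  - move=> e eT; case: (boolP (e \in R)) => [eR|/RU//].
    by have : e \in R :\: T by [rewrite inE eT]; rewrite Qg => /set1P ->.
  - by move=> u v uU vU; apply: conn_mono RTsub _; apply: UR.
  exists (g |: X); split; last exact: (chord T).
    by rewrite RE setUS.
  suff toV u : u \in touched R -> conn (g |: X) v0 u.
    by move=> u v uR vR; apply: conn_trans (toV _ vR); rewrite conn_sym toV.
  rewrite RE => /touchedP[e /setU1P[->|eT] ue].
    exact: conn_edge (setU11 _ _) v0g ue.
  apply: conn_mono (subsetUr _ _) _; apply: Xc => //.
  by apply/touchedP; exists e.
move=> [e1 [e2 [s1 [s2 [[e1Q e2Q e12] [es1 es2 s12] ST QE]]]]].
set Q := R :\: T in e1Q e2Q ST QE s12 *.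
set S := component _ _ in ST QE s12.
have [u1 u1U [s1U e1E]] := spokeP _ _ _ es1.
have [u2 u2U [s2U e2E]] := spokeP _ _ _ es2.
have us1 : u1 != s1 by apply: contraNneq s1U => <-.
have us2 : s2 != u2 by apply: contraNneq s2U => ->.
have s1S : s1 \in S by apply: mem_comp.
have [c1 c11 c1E] := excess_edge us1 e1E.
have [c2 c21 c2E] : exists2 c : int, c = 1 \/ c = -1 & forall v,
    excess (fun f => c * (f == e2)%:Z) v = (s2 == v)%:Z - (u2 == v)%:Z.
  by apply: excess_edge => //; rewrite setUC.
have QT : Q \subset ~: T by apply/subsetP => e; rewrite !inE => /andP[].
have offQ : off U Q \subset Q by apply/subsetP => e; rewrite inE => /andP[].
(* The whole ear is absorbed into [U :|: S], and [T] is left to decompose. *)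
have [|||X [XT Xc XP]] := IH (U :|: S) T Tn _ _ _ Tc.
- by apply/set0Pn; exists u1; rewrite inE u1U.
- move=> e eT; case: (boolP (e \in R)) => [eR|/RU eU]; last first.
    exact: subset_trans eU (subsetUl _ _).
  have /QE[->|->|eS] : e \in Q by rewrite inE eT.
  + by rewrite e1E subUset !sub1set !inE u1U conn_refl orbT.
  + by rewrite e2E subUset !sub1set in_setU u2U in_setU s12 orbT.
  + exact: subset_trans eS (subsetUr _ _).
- suff toV v : v \in U :|: S -> conn (~: T) u1 v.
    by move=> u v uU vU; apply: conn_trans (toV _ vU); rewrite conn_sym toV.
  case/setUP=> [vU|]; first by apply: conn_mono RTsub _; apply: UR.
  rewrite inE => s1v; apply: (@conn_trans _ _ s1).
    by apply: (conn_edge (e := e1)); rewrite ?(subsetP QT) // e1E !inE eqxx ?orbT.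
  exact: conn_mono (subset_trans offQ QT) s1v.
have [[e1R e1T] [e2R e2T]] := (setDP e1Q, setDP e2Q).
exists (X :|: [set e1; e2]); split=> [|u v uR vR|h].
- by rewrite subUset (subset_trans XT TR) subUset !sub1set e1R.
- have s1T : s1 \in touched T by apply: (subsetP ST).
  suff toV w : w \in touched R -> conn (X :|: [set e1; e2]) s1 w.
    by apply: conn_trans (toV _ vR); rewrite conn_sym toV.
  have inT x : x \in touched T -> conn (X :|: [set e1; e2]) s1 x.
    by move=> xT; apply: conn_mono (subsetUl _ _) _; apply: Xc.
  have e1X : e1 \in X :|: [set e1; e2] by rewrite !inE eqxx orbT.
  have e2X : e2 \in X :|: [set e1; e2] by rewrite !inE eqxx !orbT.
  case/touchedP=> e eR we; case: (boolP (e \in T)) => eT.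
    by apply: inT; apply/touchedP; exists e.
  have /QE[ee|ee|eS] : e \in Q by rewrite inE eT.
  + by apply: (conn_edge e1X); [rewrite e1E !inE eqxx orbT | rewrite -ee].
  + apply: (@conn_trans _ _ s2); first by apply: inT; apply: (subsetP ST).
    by apply: (conn_edge e2X); [rewrite e2E !inE eqxx orbT | rewrite -ee].
  + by apply: inT; apply: (subsetP ST); apply: (subsetP eS).
have [phi phi0 phiX] := XP h.
have [|p1 p1Q p1E] := @unit_flow (off U Q) s1 s2; first by move: s12; rewrite inE.
have [|p2 p2R p2E] := @unit_flow (~: R) u2 u1; first exact: UR.
(* The circulation runs from [u1] through [e1] to [s1], inside [S] to [s2], through [e2] to [u2],
   and back through edges removed earlier. *)
pose C e := c1 * (e == e1)%:Z + p1 e + (c2 * (e == e2)%:Z + p2 e).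
have C0 v : excess C v = 0.
  by rewrite excessD excessD c1E p1E excessD c2E p2E; ring.
have CT e : e \in T -> C e = 0.
  move=> eT; rewrite /C p1Q; last first.
    by apply: contraTN eT => /(subsetP offQ); rewrite inE => /andP[].
  rewrite p2R ?inE ?negbK ?(subsetP TR) //.
  rewrite (_ : (e == e1) = false); last by apply: contraNF e1T => /eqP <-.
  rewrite (_ : (e == e2) = false); last by apply: contraNF e2T => /eqP <-.
  by rewrite !mulr0 !addr0.
have C1 : C e1 = c1.
  rewrite /C eqxx (negPf e12) p1Q ?(spoke_off _ es1) // p2R ?inE ?negbK //.
  by rewrite mulr1 mulr0 !addr0.
have C2 : C e2 = c2.
  rewrite /C eqxx (eq_sym e2) (negPf e12) p1Q ?(spoke_off _ es2) //.
  by rewrite p2R ?inE ?negbK // mulr1 mulr0 !add0r addr0.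
have [k [k1 k2]] := avoid_mod3 (h e1 + phi e1) (h e2 + phi e2) c11 c21.
exists (fun e => phi e + k * C e) => [v|e].
  by rewrite excessD excessZ phi0 C0 mulr0 addr0.
case/setUP=> [eX|/set2P[]->]; last 2 first.
- by rewrite C1 addrA.
- by rewrite C2 addrA.
by rewrite CT ?(subsetP XT) // mulr0 addr0 phiX.
Qed.

End IntegerFlows.

(** * From modular to bounded flows *)

Section ModularFlows.
Variables (G : multigraph) (D : orientation G) (n : int).
Notation V := (vertex G).
Notation E := (edge G).
Implicit Types (u v w x y : V) (e : E) (phi psi f : E -> int).
Hypothesis n_gt0 : 0 < n.

(** Arcs follow the actual direction of the flow. Changing the value by [n] against this direction
    keeps it within the bounds and transfers [n] units of excess from [x] to [y]. *)
Definition residual f : rel V := fun x y =>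
  [exists e, [&& tail D e == x, Defs.head D e == y & 0 < f e]
          || [&& tail D e == y, Defs.head D e == x & f e < 0]].

Lemma push f x p : (forall e, `|f e| < n) -> path (residual f) x p ->
  uniq (x :: p) -> exists f', [/\ forall e, `|f' e| < n,
    forall e, (n %| f' e - f e)%Z,
    forall v, excess D f' v = excess D f v - n * ((x == v)%:Z - (last x p == v)%:Z) &
    forall e, ~~ (ends e \subset x :: p) -> f' e = f e].
Proof.
move=> fn; elim: p x => [|y p IH] x.
  move=> _ _; exists f; split=> // [e|v]; first by rewrite subrr dvdz0.
  by rewrite subrr mulr0 subr0.
move=> /andP[/existsP[e eP] yp] /andP[xyp uyp].
have [f1 [f1n f1f f1E f1p]] := IH y yp uyp.
have eE : ends e = [set x; y].
  rewrite (tail_headE D).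
  by case/orP: eP => /and3P[/eqP -> /eqP -> _] //; rewrite setUC.
(* The path is simple, so the pushes beyond [y] have not altered [e]. *)
have f1e : f1 e = f e.
  apply: f1p; apply/subsetPn; exists x; rewrite ?eE ?inE ?eqxx //.
have xy : x != y by apply: contraNneq xyp => ->; rewrite inE eqxx.
pose c : int := if 0 < f e then 1 else -1.
have cE v : c * incidence D e v = (x == v)%:Z - (y == v)%:Z.
  rewrite /c /incidence.
  case/orP: eP => /and3P[/eqP -> /eqP -> fe]; first by rewrite fe mul1r.
  by rewrite (lt_gtF fe) mulN1r opprB.
exists (fun e' => f1 e' + - n * (c * (e' == e)%:Z)); split.
- move=> e'; case: eqVneq => [->|_]; last by rewrite !mulr0 addr0.
  have := fn e; rewrite f1e mulr1 /c.
  case/orP: eP => /and3P[_ _ fe]; first by rewrite fe; lia.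
  by rewrite (lt_gtF fe); lia.
- move=> e'; rewrite addrAC rpredD // mulNr rpredN.
  by rewrite dvdz_mulr.
- move=> v; rewrite excessD excessZ f1E /=.
  by rewrite excess_single cE; ring.
- move=> e' e'p; rewrite f1p.
    rewrite (_ : (e' == e) = false) ?mulr0 ?addr0 //.
    apply: contraNF e'p => /eqP ->; rewrite eE.
    by apply/subsetP => z; rewrite !inE => /orP[]/eqP ->; rewrite eqxx ?orbT.
  apply: contraNN e'p => /subsetP e'p; apply/subsetP => z /e'p.
  by rewrite !inE => ->; rewrite orbT.
Qed.

Lemma sum_excess f (A : {set V}) : \sum_(v in A) excess D f v =
  \sum_e f e * ((tail D e \in A)%:Z - (Defs.head D e \in A)%:Z).
Proof.
rewrite exchange_big; apply: eq_bigr => e _; rewrite -big_distrr sumrB.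
have delta w : \sum_(v in A) (w == v)%:Z = (w \in A)%:Z :> int.
  case: (boolP (w \in A)) => wA.
    rewrite (bigD1 w) //= eqxx big1 ?addr0 // => v /andP[_ /negPf vw].
    by rewrite eq_sym vw.
  by rewrite big1 // => v vA; case: eqVneq => // wv; rewrite wv vA in wA.
by rewrite !delta.
Qed.

(** No flow leaves the set of vertices reachable from [s], so its total excess is at most 0. *)
Lemma reach_deficit f s : 0 < excess D f s ->
  exists2 t, connect (residual f) s t & excess D f t < 0.
Proof.
move=> s_gt0; apply/exists_inP; apply: contraLR s_gt0 => /existsPn no_t.
have {no_t} t_ge0 t : connect (residual f) s t -> 0 <= excess D f t.
  by move=> st; have := no_t t; rewrite st -leNgt.
pose A := [set t | connect (residual f) s t].
have : \sum_(v in A) excess D f v <= 0.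
  rewrite sum_excess; apply: sumr_le0 => e _; rewrite !inE.
  case: (boolP (connect _ s (tail D e))) => sT;
    case: (boolP (connect _ s (Defs.head D e))) => sH; rewrite ?subrr ?mulr0 //.
    rewrite subr0 mulr1 leNgt; apply: contraNN sH => fe.
    apply: connect_trans sT (connect1 _); apply/existsP; exists e.
    by rewrite !eqxx fe.
  rewrite sub0r mulrN1 oppr_le0 leNgt; apply: contraNN sT => fe.
  apply: connect_trans sH (connect1 _); apply/existsP; exists e.
  by rewrite !eqxx fe orbT.
rewrite (bigD1 s) /=; last by rewrite inE connect0.
rewrite -leNgt; apply: le_trans; rewrite lerDl.
by apply: sumr_ge0 => v /andP[]; rewrite inE => /t_ge0.
Qed.

(** Induction on the total absolute excess: excesses are multiples of [n], so pushing [n] units from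
    a surplus to a deficit lowers the total. *)
Lemma bounded_flow_rec m f : (\sum_v `|excess D f v|%N <= m)%N ->
  (forall e, `|f e| < n) -> (forall v, (n %| excess D f v)%Z) ->
  exists f', [/\ forall e, `|f' e| < n, forall e, (n %| f' e - f e)%Z &
    forall v, excess D f' v = 0].
Proof.
elim: m f => [|m IH] f fm fn nf.
  exists f; split=> // [e|v]; first by rewrite subrr dvdz0.
  apply/eqP; rewrite -absz_eq0 -leqn0; apply: leq_trans fm.
  by rewrite (bigD1 v) //= leq_addr.
case: (boolP [forall v, excess D f v == 0]) => [/forallP f0|f0].
  by exists f; split=> // [e|v]; [rewrite subrr dvdz0 | apply/eqP].
have [s s_gt0] : exists s, 0 < excess D f s.
  apply/existsP; apply: contraNT f0 => /existsPn no_s.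
  have sum0 : \sum_(v in [set: V]) - excess D f v = 0.
    rewrite sumrN sum_excess big1 ?oppr0 // => e _.
    by rewrite !in_setT subrr mulr0.
  have := psumr_eq0P _ sum0 => E0; apply/forallP => v.
  rewrite -oppr_eq0; apply/eqP/E0; rewrite ?in_setT // => w _.
  by rewrite oppr_ge0 leNgt no_s.
have [t /connectP[p0 p0P ->]] := reach_deficit s_gt0.
case/shortenP: p0P => p pP pu _ t_lt0.
have [f1 [f1n f1f f1E _]] := push fn pP pu.
have st : s != last s p by apply: contraTneq s_gt0 => ->; rewrite -leNgt ltW.
have dvd_bound (a : int) : (n %| a)%Z -> 0 < a -> n <= a.
  by move=> na a0; have := dvdn_leq _ na; lia.
have [||f' [f'n f'f1 f'0]] := IH f1 _ f1n.
- rewrite -ltnS; apply: leq_trans fm.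
  (* Strict decrease occurs exactly at [s] and [last s p], where the excess is at least [n] in
     absolute value and moves by [n] towards 0. *)
  have dec v : (`|excess D f1 v| <= `|excess D f v|
      ?= iff (v != s) && (v != last s p))%N.
    rewrite f1E (eq_sym v) (eq_sym v); case: (eqVneq s v) => [sv|_] /=.
      have := dvd_bound _ (nf v); rewrite -sv eq_sym (negPf st) => /(_ s_gt0) ns.
      by apply/leqifP; lia.
    case: (eqVneq (last s p) v) => [tv|_] /=; last first.
      by apply/leqifP; rewrite subrr mulr0 subr0.
    have := dvd_bound (- excess D f v); rewrite rpredN nf -tv oppr_gt0.
    by move=> /(_ isT t_lt0) ns; apply/leqifP; lia.
  rewrite (bigD1 s) //= [leqRHS](bigD1 s) //= -addSn leq_add //.
    by rewrite (ltn_leqif (dec s)) eqxx.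
  by apply: leq_sum => v _; case: (dec v).
- by move=> v; rewrite f1E rpredB // dvdz_mulr.
exists f'; split=> // e.
by rewrite -(subrK (f1 e) (f' e)) -addrA rpredD.
Qed.

(** Start from the residues of [phi] modulo [n], whose excesses are multiples of [n]. *)
Lemma bounded_flow phi : (forall v, excess D phi v = 0) ->
  exists f, [/\ forall e, `|f e| < n, forall e, (n %| f e - phi e)%Z &
    forall v, excess D f v = 0].
Proof.
move=> phi0; pose r e := (phi e %% n)%Z.
have phiE e : r e = phi e + - n * (phi e %/ n)%Z.
  by rewrite [X in X + _](divz_eq _ n) /r; ring.
have [||f [fn fr f0]] := @bounded_flow_rec _ r (leqnn _).
- move=> e; rewrite ger0_norm ?modz_ge0 ?gt_eqF //.
  by rewrite -[ltRHS](gtr0_norm n_gt0) ltz_mod ?gt_eqF.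
- move=> v; rewrite (_ : excess D r v = - n * excess D (fun e => (phi e %/ n)%Z) v).
    by rewrite mulNr rpredN dvdz_mulr.
  rewrite -excessZ -[RHS]add0r -(phi0 v) -excessD.
  by apply: eq_bigr => e _; rewrite phiE.
exists f; split=> // e.
rewrite -(subrK (r e) (f e)) -addrA rpredD // phiE addrAC subrr add0r.
by rewrite mulNr rpredN dvdz_mulr.
Qed.

End ModularFlows.

(** * Circular flows *)

Lemma orientation_exists (G : multigraph) : exists D : orientation G, True.
Proof.
have /fin_all_exists[th thP] (e : edge G) :
    exists p : vertex G * vertex G, ends e = [set p.1; p.2].
  by have [u [v [_ ->]]] := endsP e; exists (u, v).
by exists (Orientation thP).
Qed.

Lemma conn_edge_connected (G : multigraph) k u v : (0 < k)%N ->
  edge_connected k G -> @conn G setT u v.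
Proof.
move=> k0 /(_ set0); rewrite cards0 => /(_ k0)[_ /(_ u v)].
apply: connect_sub => x y /existsP[e /andP[_ exy]].
by apply/connect1/exists_inP; exists e; rewrite ?inE.
Qed.

Lemma connected_mod3_flow (G : multigraph) (D : orientation G) :
  edge_connected 3 G -> exists (X : {set edge G}) (phi : edge G -> int),
    [/\ forall u v, conn X u v, forall v, excess D phi v = 0 &
        forall e, e \in X -> ~~ (3 %| phi e)%Z].
Proof.
move=> G3.
have cut3 (S : {set vertex G}) : S != set0 -> S != setT -> (3 <= #|cut S|)%N.
  exact: cut_edge_connected.
have [|[r _] _] := G3 set0; first by rewrite cards0.
have [||||X [_ Xc /(_ (fun=> 0))[phi phi0 phiX]]] :=
  @connected_mod3_flow_rec G D cut3 #|[set: edge G]| [set r] setT (leqnn _).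
- by apply/set0Pn; exists r; rewrite inE.
- by move=> e; rewrite inE.
- by move=> u v /set1P -> /set1P ->; apply: conn_refl.
- by apply/connected_edgesP => u v _ _; apply: conn_edge_connected G3.
exists X, phi; split=> // [u v|e /phiX]; last by rewrite add0r.
(* The case [u = v] covers the one-vertex graph, whose vertex meets no edge. *)
case: (eqVneq u v) => [->|uv]; first exact: conn_refl.
have touch x y : x != y -> x \in touched [set: edge G].
  move=> xy; have xyc : conn setT x y by apply: conn_edge_connected G3.
  have [||e _] := @conn_cross _ _ [set x] _ _ xyc; rewrite ?set11 //.
    by rewrite in_set1 eq_sym.
  by case/mem_cut=> z [_ [ze _ /set1P <- _]]; apply/touchedP; exists e.
by apply: Xc; [apply: touch uv | apply: (touch v u); rewrite eq_sym].
Qed.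

Section CircularFlow.
Variables (R : realType) (G : signed_graph) (D : orientation G).

Lemma boundary_excess (f : edge G -> int) v :
  boundary D (fun e => (f e)%:~R : R) v = (excess D f v)%:~R.
Proof.
rewrite /boundary /excess [X in X - _]big_mkcond [X in _ - X]big_mkcond -sumrB.
rewrite rmorph_sum; apply: eq_bigr => e _; rewrite rmorphM rmorphB /=.
by do 2!case: (_ == v); rewrite ?(mulr1, mulr0, subr0, subrr, sub0r, mulrN1).
Qed.

(** For [r = 2k] and integer values, the intervals exclude just 0 on positive edges and [k], [-k] on
    negative ones. *)
Lemma circular_flow_of_int (k : nat) (f : edge G -> int) :
  (forall e, `|f e| < k.*2%:Z) -> (forall e, positive e -> f e != 0) ->
  (forall e, ~~ positive e -> `|f e| != k%:Z) ->
  (forall v, excess D f v = 0) ->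
  circular_flow (k.*2%:R : R) D (fun e => (f e)%:~R).
Proof.
move=> fk fpos fneg f0.
split=> [e|e epos|e eneg|v]; last by rewrite boundary_excess f0.
- rewrite in_itv /= -(@ltr_norml R) -intr_norm -[k.*2%:R]/(k.*2%:Z%:~R).
  by rewrite ltr_int.
- rewrite in_itv /= -intr_norm -[k.*2%:R]/(k.*2%:Z%:~R) -[1]/(1%:~R) -intrB.
  by rewrite !ler_int; have := fk e; have := fpos e epos; lia.
have half : k.*2%:R / 2 = k%:Z%:~R :> R.
  by rewrite -muln2 natrM mulfK // pnatr_eq0.
rewrite half !in_itv /= normr_ge0 -intr_norm -[k.*2%:R]/(k.*2%:Z%:~R).
rewrite -[1]/(1%:~R) -intrB -intrD !ler_int ltr_int.
by have := fk e; have := fneg e eneg; lia.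
Qed.

(** The forbidden residue [bad e] is a multiple of [k]. On [X], [phi + k psi] avoids it already
    modulo [k]; off [X], the choice of [psi] does so modulo [2k]. *)
Lemma admits_circular_flow_double (k : nat) (X : {set edge G})
    (phi : edge G -> int) : (0 < k)%N -> (forall u v, conn X u v) ->
  (forall v, excess D phi v = 0) -> (forall e, e \in X -> ~~ (k %| phi e)%Z) ->
  admits_circular_flow (k.*2%:R : R) G.
Proof.
move=> k0 Xc phi0 phiX.
pose bad (e : edge G) : int := if positive e then 0 else k.
(* The values 0 and 1 of [p] give different residues modulo [2k], so one of them avoids [bad e]. *)
have choice e : exists p : int, ~~ (k.*2 %| phi e + k%:Z * p - bad e)%Z.
  case: (boolP (k.*2 %| phi e - bad e)%Z) => [d|]; last by exists 0; rewrite mulr0 addr0.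
  exists 1; rewrite mulr1 addrAC rpredDl // dvdzE /=.
  by apply/negP => /dvdn_leq; lia.
have /fin_all_exists[p pP] := choice.
have [psi psi0 psiX] := flow_prescribed D p Xc.
pose f (e : edge G) := phi e + k%:Z * psi e.
have f0 v : excess D f v = 0 by rewrite excessD excessZ phi0 psi0 mulr0 addr0.
have fbad e : ~~ (k.*2 %| f e - bad e)%Z.
  case: (boolP (e \in X)) => eX; last by rewrite /f psiX.
  apply: contraNN (phiX e eX) => d.
  have kd : (k %| f e - bad e)%Z by apply: dvdz_trans d; rewrite dvdzE /= -muln2 dvdn_mulr.
  have kbad : (k %| bad e)%Z by rewrite /bad; case: ifP => _; rewrite ?dvdz0 ?dvdzz.
  have := rpredD kd kbad; rewrite subrK /f => kf.
  by rewrite -(addrK (k%:Z * psi e) (phi e)) rpredB // dvdz_mulr.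
have k20 : 0 < k.*2%:Z by lia.
have [g [gk gf g0]] := bounded_flow k20 f0.
have gbad e : ~~ (k.*2 %| g e - bad e)%Z.
  apply: contraNN (fbad e) => d.
  have -> : f e - bad e = g e - bad e - (g e - f e) by ring.
  exact: rpredB.
exists D, (fun e => (g e)%:~R); apply: circular_flow_of_int => // e ep.
  by apply: contraNneq (gbad e) => ->; rewrite /bad ep subrr dvdz0.
apply: contraNneq (gbad e) => ge; rewrite /bad (negPf ep).
(* The values [k] and [-k] agree modulo [2k], so a single forbidden residue rules out both. *)
have [->|->] : g e = k \/ g e = - k%:Z by lia.
  by rewrite subrr dvdz0.
by rewrite -opprD rpredN dvdzE /= addnn dvdnn.
Qed.

End CircularFlow.

Theorem theorem5p6 (R : realType) :
  (forall G : signed_graph,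
     edge_connected 3 G -> admits_circular_flow (6 : R) G) /\
  (forall G : signed_graph,
     edge_connected 4 G -> admits_circular_flow (4 : R) G).
Proof.
split=> G Gk; have [D _] := orientation_exists G.
  have [X [phi [Xc phi0 phiX]]] := connected_mod3_flow D Gk.
  exact: (@admits_circular_flow_double R G D 3 X phi).
have [X [Xc XCc]] := connected_partition Gk.
(* Corrections are confined to the complement of [X], so [phi] equals 1, an odd value, on [X]. *)
have [phi phi0 phiX] := flow_prescribed D (fun=> 1) XCc.
apply: (@admits_circular_flow_double R G D 2 X phi) => // e eX.
by rewrite phiX // inE negbK.
Qed.
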